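(* Assume that $g$ and $\psi_{\ell-1}$, $\ell\in[L]$, are directionally differentiable everywhere and locally Lipschitz continuous, and that $g$ and each component of each $\psi_{\ell-1}$, $\ell\in[L]$, are twice semidifferentiable on $\mathbb{R}^{\bar N_L}$ and $\mathbb{R}^{n+\bar N_{\ell-1}}$, respectively. Let the penalty parameters $\beta_\ell>0$ satisfy $$\beta_\ell>K_g\prod_{j=\ell+1}^{L}(1+K_{j-1})\quad\text{for all }\ell\in[L],$$ where $K_g$ and $K_1,\dots,K_{L-1}$ are the Lipschitz constants described in the context. Let $z=(\theta,u)\in lev_{\le\bar\gamma}\Theta$. If $$\Theta'(z;d)\ge0\ \text{ for all }d\in\mathbb{R}^{\bar N}$$ and $$F^{(2)}(z;d)-\sum_{\ell=1}^{L}\beta_\ell\,\|\psi_{\ell-1}^{(2)}(\theta,\mathbf{u}_{\ell-1};d_\theta,d_{\mathbf{u}_{\ell-1}})\|_1>0\ \text{ for all }d\ne\mathbf{0}\text{ with }\Theta'(z;d)=0,$$ then $z$ is a strong local minimizer of (P1) and $\theta$ is a strong local minimizer of (P).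
   Context: Let $n,L,N_1,\dots,N_L$ be positive integers, $[L]=\{1,\dots,L\}$, $\bar N_0=0$, $\bar N_\ell=\sum_{j=1}^{\ell}N_j$, $\bar N=n+\bar N_L$, $\lambda>0$. Let $g:\mathbb{R}^{\bar N_L}\to[0,\infty)$ and $\psi_{\ell-1}:\mathbb{R}^{n+\bar N_{\ell-1}}\to\mathbb{R}^{N_\ell}$ ($\ell\in[L]$) be continuous. Write $u=(u_1,\dots,u_L)$ with $u_\ell\in\mathbb{R}^{N_\ell}$, $\mathbf{u}_\ell=(u_1,\dots,u_\ell)$, $\mathbf{u}_0$ empty, $z=(\theta,u)\in\mathbb{R}^{\bar N}$ with $\theta\in\mathbb{R}^n$; directions are split in the same way, $d=(d_\theta,d_{u_1},\dots,d_{u_L})$, $d_{\mathbf{u}_\ell}=(d_{u_1},\dots,d_{u_\ell})$. $\|\cdot\|$ is the Euclidean norm. Empty products equal $1$. $\Psi(\theta)=g(u_1,\dots,u_L)$ where $u_1=\psi_0(\theta)$, $u_\ell=\psi_{\ell-1}(\theta,u_1,\dots,u_{\ell-1})$ for $\ell=2,\dots,L$. Problem (P): $\min_{\theta\in\mathbb{R}^n}\Psi(\theta)+\lambda\|\theta\|^2$. $F(z)=g(u)+\lambda\|\theta\|^2$; $\Theta(z)=F(z)+\sum_{\ell=1}^{L}\beta_\ell\|u_\ell-\psi_{\ell-1}(\theta,\mathbf{u}_{\ell-1})\|_1$ with $\beta_\ell>0$. Problem (P1): $\min_{z\in\mathbb{R}^{\bar N}}\Theta(z)$. Directional derivative: $f'(x;d)=\lim_{\tau\downarrow0}\frac{f(x+\tau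 d)-f(x)}{\tau}$; second-order: $f^{(2)}(x;d)=\lim_{\tau\downarrow0}\frac{f(x+\tau d)-f(x)-\tau f'(x;d)}{\tau^2/2}$ (componentwise for vector-valued $f$). A real-valued $f$ is twice semidifferentiable at $x$ if for all $d$ the (finite) limits $\mathrm{d}f(x)(d):=\lim_{\tau\downarrow0,\,d'\to d}\frac{f(x+\tau d')-f(x)}{\tau}$ and $\lim_{\tau\downarrow0,\,d'\to d}\frac{f(x+\tau d')-f(x)-\tau\,\mathrm{d}f(x)(d')}{\tau^2/2}$ exist. Strong local minimizer: for $f:\mathcal{F}\subseteq\mathbb{R}^m\to\mathbb{R}$, $x\in\mathcal{F}$ is a strong local minimizer of $f$ on $\mathcal{F}$ if there exist $\epsilon_1,\epsilon_2>0$ such that $f(\bar x)\ge f(x)+\epsilon_1\|\bar x-x\|^2$ for all $\bar x\in\mathcal{F}$ with $\|\bar x-x\|\le\epsilon_2$. Level $\bar\gamma$: let $z^0=(\mathbf{0},u_1^0,\dots,u_L^0)$ with $u_\ell^0=\psi_{\ell-1}(\mathbf{0},u_1^0,\dots,u_{\ell-1}^0)$ for $\ell=1,\dots,L$, and $\bar\gamma=\Theta(z^0)=F(z^0)$. Let $lev_{\le\bar\gamma}\Theta=\{z\mid\Theta(z)\le\bar\gamma\}$ (a compact set). Lipschitz constants: $K_g>0$ and $K_\ell>0$ ($\ell\in[L-1]$) are constants such that for some (sufficiently small) $\epsilon>0$, $|g(u)-g(\bar u)|\le K_g\|u-\bar u\|$ and $\|\psi_{\ell-1}(\theta,\mathbf{u}_{\ell-1})-\psi_{\ell-1}(\theta,\bar{\mathbf{u}}_{\ell-1})\|\le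 K_{\ell-1}\|\mathbf{u}_{\ell-1}-\bar{\mathbf{u}}_{\ell-1}\|$ for $\ell=2,\dots,L$, for all $(\theta,u),(\theta,\bar u)\in lev_{\le\bar\gamma}\Theta+\epsilon\mathbb{B}$, where $\mathbb{B}$ is the closed unit ball of $\mathbb{R}^{\bar N}$. (Such constants exist under the stated local Lipschitz assumption.) *)

(* Defs.v *)
From HB Require Import structures.
From mathcomp Require Import all_boot all_order all_algebra.
From mathcomp Require Import all_classical all_reals all_analysis.

Set Implicit Arguments.
Unset Strict Implicit.
Unset Printing Implicit Defensive.

Import Order.TTheory GRing.Theory Num.Theory.
Import numFieldNormedType.Exports.

Local Open Scope classical_set_scope.
Local Open Scope ring_scope.

(* The library norm on ['rV[R]_m] is the sup norm, hence [norm2]; the topology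
   is the same. *)
Definition norm2 (R : realType) (m : nat) (x : 'rV[R]_m) : R :=
  Num.sqrt (\sum_i x 0 i ^+ 2).

Definition norm1 (R : realType) (m : nat) (x : 'rV[R]_m) : R :=
  \sum_i `|x 0 i|.

(* Stated with the library norms: the norms of R^m being equivalent, the choice
   only affects the local constants. *)
Definition locally_lipschitz (R : realType) (V W : normedModType R)
    (f : V -> W) : Prop :=
  forall x : V, lipschitz_on f (nbhs (x, x)).

Definition component (R : realType) (m p : nat) (f : 'rV[R]_m -> 'rV[R]_p)
    (j : 'I_p) : 'rV[R]_m -> R :=
  fun x => f x 0 j.

Section Directional.
Variables (R : realType) (m : nat).
Implicit Types (f : 'rV[R]_m -> R) (x d : 'rV[R]_m).

Definition dquot f x d (t : R) : R := (f (x + t *: d) - f x) / t.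

Definition dirdiff f : Prop := forall x d, cvg (dquot f x d t @[t --> 0^'+]).

Definition dird f x d : R := lim (dquot f x d t @[t --> 0^'+]).

(* second-order quotient, [D] being the first-order term *)
Definition dquot2 f (D : 'rV[R]_m -> R) x d (t : R) : R :=
  (f (x + t *: d) - f x - t * D d) / (t ^+ 2 / 2).

Definition dird2 f x d : R :=
  lim (dquot2 f (dird f x) x d t @[t --> 0^'+]).

(* The limits below are taken jointly in [p.1 = tau] and in the direction
   [p.2 = d']. *)
Definition semid f x d : R :=
  lim (dquot f x p.2 p.1 @[p --> (0^'+, nbhs d)]).

Definition twice_semidiff f x : Prop :=
  forall d, cvg (dquot f x p.2 p.1 @[p --> (0^'+, nbhs d)]) /\
            cvg (dquot2 f (semid f x) x p.2 p.1 @[p --> (0^'+, nbhs d)]).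

Definition strong_local_minimizer (A : set 'rV[R]_m) f x : Prop :=
  A x /\ exists e1 e2 : R, [/\ 0 < e1, 0 < e2 &
    forall y, A y -> norm2 (y - x) <= e2 -> f x + e1 * norm2 (y - x) ^+ 2 <= f y].

End Directional.

Definition vdird2 (R : realType) (m p : nat) (f : 'rV[R]_m -> 'rV[R]_p)
    (x d : 'rV[R]_m) : 'rV[R]_p :=
  \row_j dird2 (component f j) x d.

(* [Nbar N l] is N 1 + ... + N l (see [NbarE]).  It is a fixpoint so that
   [Nbar N l.+1] is convertible to [Nbar N l + N l.+1]: the vectors
   (u_1, ..., u_l) and u_(l+1) can be concatenated without casts. *)
Fixpoint Nbar (N : nat -> nat) (l : nat) : nat :=
  if l is k.+1 then (Nbar N k + N k.+1)%N else 0%N.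

Lemma NbarE (N : nat -> nat) (l : nat) :
  Nbar N l = (\sum_(1 <= j < l.+1) N j)%N.
Proof.
elim: l => [|l IHl]; first by rewrite big_geq.
by rewrite big_nat_recr //= -IHl.
Qed.

Lemma leq_Nbar (N : nat -> nat) (k l : nat) :
  (k <= l)%N -> (Nbar N k <= Nbar N l)%N.
Proof.
elim: l => [|l IHl]; first by rewrite leqn0 => /eqP ->.
rewrite leq_eqVlt => /orP[/eqP -> //|]; rewrite ltnS => /IHl h.
exact: leq_trans h (leq_addr _ _).
Qed.

Section Network.
Variables (R : realType) (n L : nat) (N : nat -> nat).

(* The families indexed by layers are total in [l]; only [N l], [beta l] for
   1 <= l <= L and [psi l] for l < L are relevant. *)
Variable g : 'rV[R]_(Nbar N L) -> R.
Variable psi : forall l : nat, 'rV[R]_(n + Nbar N l) -> 'rV[R]_(N l.+1).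
Variables (lambda : R) (beta : nat -> R).
Implicit Types (theta : 'rV[R]_n) (u : 'rV[R]_(Nbar N L))
  (z d : 'rV[R]_(n + Nbar N L)).

(* (u_1, ..., u_k) *)
Definition uprefix (k : nat) (hk : (k <= L)%N) u : 'rV[R]_(Nbar N k) :=
  colsub (widen_ord (leq_Nbar N hk)) u.

(* u_(l+1), the last block of (u_1, ..., u_(l+1)) *)
Definition ublock (l : 'I_L) u : 'rV[R]_(N l.+1) :=
  @rsubmx R 1 (Nbar N l) (N l.+1) (uprefix (ltn_ord l) u).

(* (theta, u_1, ..., u_l), the argument of psi_l *)
Definition layer_input (l : 'I_L) z : 'rV[R]_(n + Nbar N l) :=
  row_mx (lsubmx z) (uprefix (ltnW (ltn_ord l)) (rsubmx z)).

(* (u_1, ..., u_l) with u_(k+1) = psi_k(theta, u_1, ..., u_k) for k < l *)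
Fixpoint forward theta (l : nat) : 'rV[R]_(Nbar N l) :=
  if l is k.+1 return 'rV[R]_(Nbar N l)
  then row_mx (forward theta k) (psi (row_mx theta (forward theta k)))
  else 0.

Definition Psi theta : R := g (forward theta L).

Definition objP theta : R := Psi theta + lambda * norm2 theta ^+ 2.

Definition F z : R := g (rsubmx z) + lambda * norm2 (lsubmx z) ^+ 2.

Definition Theta z : R :=
  F z + \sum_(l < L) beta l.+1 *
          norm1 (ublock l (rsubmx z) - psi (layer_input l z)).

Definition z0 : 'rV[R]_(n + Nbar N L) := row_mx 0 (forward 0 L).

Definition gammabar : R := Theta z0.

Definition lev : set 'rV[R]_(n + Nbar N L) := [set z | Theta z <= gammabar].

(* lev + eps B *)
Definition lev_fattened (eps : R) : set 'rV[R]_(n + Nbar N L) :=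
  [set z | exists2 w, lev w & norm2 (z - w) <= eps].

(* [K l], 1 <= l < L, is the constant of psi_l in (u_1, ..., u_l) *)
Definition lipschitz_constants (Kg : R) (K : nat -> R) : Prop :=
  exists eps : R, [/\ 0 < eps,
    (forall theta u v,
       lev_fattened eps (row_mx theta u) -> lev_fattened eps (row_mx theta v) ->
       `|g u - g v| <= Kg * norm2 (u - v)) &
    (forall (l : 'I_L) theta u v, (0 < l)%N ->
       lev_fattened eps (row_mx theta u) -> lev_fattened eps (row_mx theta v) ->
       norm2 (psi (layer_input l (row_mx theta u)) -
              psi (layer_input l (row_mx theta v))) <=
       K l * norm2 (uprefix (ltnW (ltn_ord l)) u -
                    uprefix (ltnW (ltn_ord l)) v))].

End Network.

(* Main.v *)
Require Import Defs.
From mathcomp Require Import all_boot all_order all_algebra.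
From mathcomp Require Import all_classical all_reals all_analysis.
From mathcomp Require Import ring.

Set Implicit Arguments.
Unset Strict Implicit.
Unset Printing Implicit Defensive.

Import Order.TTheory GRing.Theory Num.Theory.
Import numFieldNormedType.Exports.

Local Open Scope classical_set_scope.
Local Open Scope ring_scope.

(** The residual of layer [l] at [z = (theta, u)] is
    [u_(l+1) - psi_l (theta, u_1, ..., u_l)]; [z] is feasible when all residuals
    vanish, and then [Theta z] is the value of the network objective at [theta].

    Stationarity forces feasibility ([stationary_feasible]). Fix [theta] and move
    each block by the directional derivative of its layer along the motion of the
    earlier blocks, minus its own residual. All residuals then shrink at unit
    relative rate, so the penalty falls at rate [\sum_l beta_l * norm1 (resid_l)].
    The Lipschitz bounds, propagated through the layers
    ([norm2_assemble_le]), show that [g] rises at most at rate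
    [\sum_l Kg * \prod_j (1 + K_j) * norm1 (resid_l)]. By the choice of [beta] the
    derivative of [Theta] in this direction is negative unless every residual
    is zero.

    At a feasible point the second-order expansions of [F] and of the layers,
    together with the reverse triangle inequality for each penalty term, give
    ([Theta_expansion])
      [Theta (z + t d) >= Theta z + t Theta'(z; d) + t^2/2 Q(t, d)],
    where [Q(t, d')] tends to the second-order quantity of the hypothesis as [t]
    decreases to 0 and [d'] tends to [d]. The linear term is nonnegative for
    every direction, so near a unit direction [d] with [Theta'(z; d) = 0] the growth
    is at least quadratic because [Q] is bounded below by a positive constant;
    near the other unit directions it is even linear. Since the expansion holds
    jointly in the step and the direction, compactness of the unit sphere turns
    these local bounds into one quadratic growth constant
    ([strong_local_minimizer_directional]).

    Finally [theta |-> (theta, forward pass of theta)] is continuous, does not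
    decrease distances, and pulls [Theta] back to the network objective, so the
    growth of [Theta] at [z] restricts to growth of that objective at [theta]
    ([objP_strong_local_minimizer]). *)

(** * Euclidean and l1 norms *)

Section Norms.
Variables (R : realType).
Implicit Types m p : nat.

Lemma norm2_ge0 m (x : 'rV[R]_m) : 0 <= norm2 x.
Proof. exact: sqrtr_ge0. Qed.

Lemma sqr_norm2 m (x : 'rV[R]_m) : norm2 x ^+ 2 = \sum_i x 0 i ^+ 2.
Proof. by rewrite sqr_sqrtr// sumr_ge0// => i _; exact: sqr_ge0. Qed.

Lemma norm2_le m (x : 'rV[R]_m) (a : R) :
  0 <= a -> \sum_i x 0 i ^+ 2 <= a ^+ 2 -> norm2 x <= a.
Proof. by move=> a0; rewrite -sqr_norm2 ler_pXn2r// nnegrE norm2_ge0. Qed.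

Lemma norm2_0 m : norm2 (0 : 'rV[R]_m) = 0.
Proof.
by apply/eqP; rewrite sqrtr_eq0 big1// => i _; rewrite mxE expr0n.
Qed.

Lemma norm2_eq0 m (x : 'rV[R]_m) : norm2 x = 0 -> x = 0.
Proof.
move=> x0; have /esym := sqr_norm2 x; rewrite x0 expr0n/= => h.
apply/rowP => i; rewrite mxE; apply/eqP; rewrite -sqrf_eq0; apply/eqP.
by move: h => /psumr_eq0P -> // j _; exact: sqr_ge0.
Qed.

Lemma norm2_gt0 m (x : 'rV[R]_m) : x != 0 -> 0 < norm2 x.
Proof.
move=> x0; rewrite lt_neqAle norm2_ge0 andbT eq_sym.
by apply: contra_neq x0 => /norm2_eq0.
Qed.

Lemma norm2Z m (a : R) (x : 'rV[R]_m) : norm2 (a *: x) = `|a| * norm2 x.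
Proof.
rewrite -sqrtr_sqr -sqrtrM ?sqr_ge0// /norm2; congr (Num.sqrt _).
by rewrite mulr_sumr; apply: eq_bigr => i _; rewrite mxE exprMn.
Qed.

Lemma norm2N m (x : 'rV[R]_m) : norm2 (- x) = norm2 x.
Proof. by rewrite -scaleN1r norm2Z normrN normr1 mul1r. Qed.

(** Young's inequality with weights [norm2 x : norm2 y] gives the triangle
    inequality without Cauchy-Schwarz. *)
Lemma ler_norm2D m (x y : 'rV[R]_m) : norm2 (x + y) <= norm2 x + norm2 y.
Proof.
have [->|x0] := eqVneq x 0; first by rewrite norm2_0 !add0r.
have [->|y0] := eqVneq y 0; first by rewrite norm2_0 !addr0.
have a0 := norm2_gt0 x0; have b0 := norm2_gt0 y0.
set a := norm2 x in a0 *; set b := norm2 y in b0 *.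
apply: norm2_le; first by rewrite addr_ge0// ltW.
have -> : (a + b) ^+ 2 =
    \sum_i ((1 + b / a) * x 0 i ^+ 2 + (1 + a / b) * y 0 i ^+ 2).
  rewrite big_split/= -!mulr_sumr -!sqr_norm2 -/a -/b.
  by field; rewrite !gt_eqF.
apply: ler_sum => i _; rewrite !mxE -subr_ge0.
suff -> : (1 + b / a) * x 0 i ^+ 2 + (1 + a / b) * y 0 i ^+ 2 -
   (x 0 i + y 0 i) ^+ 2 = (b * x 0 i - a * y 0 i) ^+ 2 / (a * b).
  by rewrite divr_ge0 ?sqr_ge0// mulr_ge0// ltW.
by field; rewrite !gt_eqF.
Qed.

Lemma sqr_norm2_row_mx m p (x : 'rV[R]_m) (y : 'rV[R]_p) :
  norm2 (row_mx x y) ^+ 2 = norm2 x ^+ 2 + norm2 y ^+ 2.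
Proof.
rewrite !sqr_norm2 big_split_ord/=.
by congr (_ + _); apply: eq_bigr => i _; rewrite ?row_mxEl ?row_mxEr.
Qed.

Lemma norm2_row_mx_le m p (x : 'rV[R]_m) (y : 'rV[R]_p) :
  norm2 (row_mx x y) <= norm2 x + norm2 y.
Proof.
have x0 := norm2_ge0 x; have y0 := norm2_ge0 y.
apply: norm2_le; first exact: addr_ge0.
by rewrite -sqr_norm2 sqr_norm2_row_mx sqrrD lerD2r lerDl mulrn_wge0// mulr_ge0.
Qed.

Lemma norm2_lsubmx_le m p (x : 'rV[R]_(m + p)) : norm2 (lsubmx x) <= norm2 x.
Proof.
rewrite -(@ler_pXn2r _ 2) ?nnegrE ?norm2_ge0//.
by rewrite -{2}(hsubmxK x) sqr_norm2_row_mx lerDl sqr_ge0.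
Qed.

Lemma norm1_ge0 m (x : 'rV[R]_m) : 0 <= norm1 x.
Proof. by rewrite sumr_ge0. Qed.

Lemma norm1_eq0 m (x : 'rV[R]_m) : norm1 x = 0 -> x = 0.
Proof.
move=> /psumr_eq0P x0; apply/rowP => i; rewrite mxE; apply/eqP.
by rewrite -normr_eq0 x0.
Qed.

Lemma norm2_le_norm1 m (x : 'rV[R]_m) : norm2 x <= norm1 x.
Proof.
apply: norm2_le; first exact: norm1_ge0.
rewrite expr2 {1}/norm1 mulr_suml; apply: ler_sum => i _.
rewrite -real_normK ?num_real// expr2 ler_wpM2l// /norm1 (bigD1 i)//= lerDl.
exact: sumr_ge0.
Qed.

Lemma normr_le_norm2 m (x : 'rV[R]_m) : `|x| <= norm2 x.
Proof.
rewrite [X in X <= _]mx_normrE; apply: bigmax_le; first exact: norm2_ge0.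
case=> i j _ /=; rewrite ord1 -(@ler_pXn2r _ 2) ?nnegrE ?norm2_ge0//.
rewrite sqr_norm2 real_normK ?num_real// (bigD1 j)//= lerDl.
by rewrite sumr_ge0// => k _; exact: sqr_ge0.
Qed.

End Norms.

(** * Convergence of row vectors *)

Section RowLimits.
Variables (R : realType) (T : Type) (G : set_system T).
Context {GF : Filter G}.

Lemma cvg_sumr (I : Type) (r : seq I) (f : I -> T -> R) (l : I -> R) :
  (forall i, f i x @[x --> G] --> l i) ->
  \sum_(i <- r) f i x @[x --> G] --> \sum_(i <- r) l i.
Proof.
move=> fl; elim: r => [|i r IH].
  by rewrite big_nil; under eq_fun do rewrite big_nil; exact: cvg_cst.
by rewrite big_cons; under eq_fun do rewrite big_cons; exact: cvgD.
Qed.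

Lemma cvg_rowP m (f : T -> 'rV[R]_m) (l : 'rV[R]_m) :
  f x @[x --> G] --> l <-> forall i, f x 0 i @[x --> G] --> l 0 i.
Proof.
split=> [fl i|fl].
  exact: (cvg_comp _ _ fl (@coord_continuous R 1 m 0 i l)).
apply/cvgrPdist_le => e e0.
have : \forall x \near G, forall i, `|l 0 i - f x 0 i| <= e.
  by apply: filter_forall => i; move/cvgrPdist_le : (fl i) => /(_ e e0).
apply: filterS => x h.
rewrite [X in X <= _]mx_normrE; apply: bigmax_le; first exact: ltW.
by case=> i j _ /=; rewrite ord1 !mxE.
Qed.

Lemma cvg_norm2 m (f : T -> 'rV[R]_m) (l : 'rV[R]_m) :
  f x @[x --> G] --> l -> norm2 (f x) @[x --> G] --> norm2 l.
Proof.
move=> /cvg_rowP fl.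
have h : \sum_i f x 0 i ^+ 2 @[x --> G] --> \sum_i l 0 i ^+ 2.
  apply: (@cvg_sumr _ _ (fun i x => f x 0 i ^+ 2)) => i.
  by rewrite expr2; under eq_fun do rewrite expr2; exact: cvgM.
exact: (cvg_comp _ _ h (@sqrt_continuous R _)).
Qed.

Lemma cvg_row_mx m p (f : T -> 'rV[R]_m) (h : T -> 'rV[R]_p)
    (a : 'rV[R]_m) (b : 'rV[R]_p) :
  f x @[x --> G] --> a -> h x @[x --> G] --> b ->
  row_mx (f x) (h x) @[x --> G] --> row_mx a b.
Proof.
move=> /cvg_rowP fa /cvg_rowP hb; apply/cvg_rowP => i.
rewrite mxE; under eq_fun do rewrite mxE.
by case: fintype.split.
Qed.

End RowLimits.

Lemma compact_sphere (R : realType) (m : nat) :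
  compact [set x : 'rV[R]_m | norm2 x = 1].
Proof.
apply: bounded_closed_compact.
  exists 1; split=> // M M1 x /= x1.
  by rewrite (le_trans (normr_le_norm2 x))// x1 ltW.
have c : {in ~` @norm2 R m @^-1` [set y | y = 1], continuous (@norm2 R m)}.
  by move=> x _; apply: (@cvg_norm2 R _ (nbhs x) _ m id); exact: cvg_id.
have e : closed [set y : R | y = 1] by exact: closed_eq.
have := preimage_closed c e; exact.
Qed.

(** * Calculus of one-sided derivatives with varying direction *)

Section Semiderivatives.
Variables (R : realType) (m : nat).
Implicit Types (f h : 'rV[R]_m -> R) (D E : 'rV[R]_m -> R) (x d : 'rV[R]_m).

(** Relations rather than [lim] terms, so that sums and compositions need no
    separate proof of existence; the first-order term [D] of the second one is a
    function because it is evaluated at the moving direction. *)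
Definition semideriv f x d (a : R) : Prop :=
  dquot f x p.2 p.1 @[p --> (0^'+, nbhs d)] --> a.

Definition semideriv2 f D x d (b : R) : Prop :=
  dquot2 f D x p.2 p.1 @[p --> (0^'+, nbhs d)] --> b.

Lemma near_small d (e : R) : 0 < e ->
  \forall p \near filter_prod (0 : R)^'+ (nbhs d), 0 < p.1 <= e.
Proof.
move=> e0; have h : \forall t \near (0 : R)^'+, 0 < t <= e.
  by apply: filterS2 (nbhs_right_gt 0) (nbhs_right_le e0) => t -> ->.
exact: (@cvg_fst _ _ (0 : R)^'+ (nbhs d) _ _ h).
Qed.

Lemma cvg_ray d : (t, d) @[t --> (0 : R)^'+] --> filter_prod (0 : R)^'+ (nbhs d).
Proof. apply: (@cvg_pair _ _ _ (0 : R)^'+ (0 : R)^'+ (nbhs d)).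
  exact: cvg_id.
exact: cvg_cst. Qed.

Lemma semideriv_cvg f x d a :
  semideriv f x d a -> dquot f x d t @[t --> 0^'+] --> a.
Proof. by move=> fa; exact: (cvg_comp _ _ (@cvg_ray d) fa). Qed.

Lemma semideriv_dird f x d a : semideriv f x d a -> dird f x d = a.
Proof. by move=> /semideriv_cvg; exact: cvg_lim. Qed.

Lemma semideriv2_dird2 f x d b :
  semideriv2 f (dird f x) x d b -> dird2 f x d = b.
Proof.
move=> fb; apply: cvg_lim => //.
exact: (cvg_comp _ _ (@cvg_ray d) fb).
Qed.

Lemma twice_semidiff_semideriv f x d :
  twice_semidiff f x -> semideriv f x d (dird f x d).
Proof.
by move=> /(_ d)[fd _]; rewrite (semideriv_dird fd).
Qed.

(** The joint limit restricts to the ray [d' = d], so the semiderivative is the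
    directional derivative and can replace it inside the second-order quotient. *)
Lemma twice_semidiff_semideriv2 f x d :
  twice_semidiff f x -> semideriv2 f (dird f x) x d (dird2 f x d).
Proof.
move=> fx; have semidE : semid f x = dird f x.
  apply/funext => d'; have [fd _] := fx d'.
  by rewrite (semideriv_dird fd).
have [_] := fx d; rewrite semidE => fd.
by rewrite (semideriv2_dird2 fd).
Qed.

Lemma semiderivD f h x d a b : semideriv f x d a -> semideriv h x d b ->
  semideriv (fun y => f y + h y) x d (a + b).
Proof.
move=> fa hb; apply: cvg_trans (cvgD fa hb); apply: near_eq_cvg.
by apply: nearW => p; rewrite fctE /dquot -mulrDl; congr (_ / _); ring.
Qed.

Lemma semideriv2D f h D E x d a b :
  semideriv2 f D x d a -> semideriv2 h E x d b ->
  semideriv2 (fun y => f y + h y) (fun y => D y + E y) x d (a + b).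
Proof.
move=> fa hb; apply: cvg_trans (cvgD fa hb); apply: near_eq_cvg.
by apply: nearW => p; rewrite fctE /dquot2 -mulrDl; congr (_ / _); ring.
Qed.

Lemma semiderivZ f (c : R) x d a :
  semideriv f x d a -> semideriv (fun y => c * f y) x d (c * a).
Proof.
move=> fa; apply: cvg_trans (cvgM (cvg_cst c) fa); apply: near_eq_cvg.
by apply: nearW => p; rewrite /dquot /= mulrA -mulrBr.
Qed.

Lemma semideriv2Z f (c : R) D x d a : semideriv2 f D x d a ->
  semideriv2 (fun y => c * f y) (fun y => c * D y) x d (c * a).
Proof.
move=> fa; apply: cvg_trans (cvgM (cvg_cst c) fa); apply: near_eq_cvg.
by apply: nearW => p; rewrite /dquot2 /= [LHS]mulrA; congr (_ / _); ring.
Qed.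

Lemma semideriv_cst (c : R) x d : semideriv (fun=> c) x d 0.
Proof.
rewrite /semideriv /dquot; under eq_fun do rewrite subrr mul0r.
exact: cvg_cst.
Qed.

Lemma semideriv2_cst (c : R) x d : semideriv2 (fun=> c) (fun=> 0) x d 0.
Proof.
rewrite /semideriv2 /dquot2.
under eq_fun do rewrite mulr0 subr0 subrr mul0r.
exact: cvg_cst.
Qed.

Lemma semideriv_sum (I : Type) (r : seq I) (f : I -> 'rV[R]_m -> R)
    (a : I -> R) x d :
  (forall i, semideriv (f i) x d (a i)) ->
  semideriv (fun y => \sum_(i <- r) f i y) x d (\sum_(i <- r) a i).
Proof.
move=> fa; elim: r => [|i r IH].
  rewrite big_nil; under eq_fun do rewrite big_nil; exact: semideriv_cst.
rewrite big_cons; under eq_fun do rewrite big_cons; exact: semiderivD.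
Qed.

Lemma semideriv2_sum (I : Type) (r : seq I) (f D : I -> 'rV[R]_m -> R)
    (a : I -> R) x d :
  (forall i, semideriv2 (f i) (D i) x d (a i)) ->
  semideriv2 (fun y => \sum_(i <- r) f i y) (fun y => \sum_(i <- r) D i y)
    x d (\sum_(i <- r) a i).
Proof.
move=> fa; elim: r => [|i r IH].
  have nilE (k : I -> 'rV[R]_m -> R) : (fun y => \sum_(i <- [::]) k i y) = fun=> 0.
    by apply/funext => y; rewrite big_nil.
  by rewrite big_nil !nilE; exact: semideriv2_cst.
have consE (k : I -> 'rV[R]_m -> R) : (fun y => \sum_(j <- i :: r) k j y) =
    fun y => k i y + \sum_(j <- r) k j y.
  by apply/funext => y; rewrite big_cons.
by rewrite big_cons !consE; exact: semideriv2D.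
Qed.

Lemma cvg_direction_coord d i :
  (p.2 : 'rV[R]_m) 0 i @[p --> filter_prod (0 : R)^'+ (nbhs d)] --> d 0 i.
Proof.
exact: (cvg_comp _ _ (@cvg_snd _ _ (0 : R)^'+ (nbhs d) _)
  (@coord_continuous R 1 m 0 i d)).
Qed.

Lemma semideriv_coord x d i : semideriv (fun y => y 0 i) x d (d 0 i).
Proof.
have c := @cvg_direction_coord d i.
apply: cvg_trans c; apply: near_eq_cvg.
near=> p; have /andP[t0 _] : 0 < p.1 <= 1 by near: p; exact: near_small.
by rewrite /dquot !mxE; field; rewrite gt_eqF.
Unshelve. all: by end_near. Qed.

Lemma semideriv2_sqr_coord x d i :
  semideriv2 (fun y => y 0 i ^+ 2) (fun y => 2 * x 0 i * y 0 i) x d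
    (2 * d 0 i ^+ 2).
Proof.
have c := @cvg_direction_coord d i.
rewrite expr2.
apply: cvg_trans (cvgM (cvg_cst (2 : R)) (cvgM c c)); apply: near_eq_cvg.
near=> p; have /andP[t0 _] : 0 < p.1 <= 1 by near: p; exact: near_small.
by rewrite /dquot2 !mxE/=; field; rewrite gt_eqF.
Unshelve. all: by end_near. Qed.

(** The first-order quotient at [(t, d')] is [D d'] plus [t / 2] times the
    second-order one, and the latter is bounded. *)
Lemma semideriv2_semideriv f D x d a b :
  D p @[p --> nbhs d] --> a -> semideriv2 f D x d b -> semideriv f x d a.
Proof.
move=> Da fb.
have c : D p.2 @[p --> filter_prod (0 : R)^'+ (nbhs d)] --> a.
  exact: (cvg_comp _ _ (@cvg_snd _ _ (0 : R)^'+ (nbhs d) _) Da).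
have t0 : p.1 @[p --> filter_prod (0 : R)^'+ (nbhs d)] --> (0 : R).
  have h : t @[t --> (0 : R)^'+] --> (0 : R) by exact: cvg_within.
  exact: (cvg_comp _ _ (@cvg_fst _ _ (0 : R)^'+ (nbhs d) _) h).
have -> : a = a + 0 * b * 2^-1 by rewrite !mul0r addr0.
apply: cvg_trans (cvgD c (cvgM (cvgM t0 fb) (cvg_cst (2^-1 : R)))).
apply: near_eq_cvg.
near=> p; have /andP[p0 _] : 0 < p.1 <= 1 by near: p; exact: near_small.
by rewrite fctE /dquot /dquot2 /=; field; rewrite gt_eqF.
Unshelve. all: by end_near. Qed.

(** The absolute value is directionally differentiable, and Lipschitz, so it
    passes through a limit of difference quotients; [A] is its directional
    derivative at [f x] along [a]. *)
Lemma semideriv_norm f x d a (A : R) :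
  (\forall t \near (0 : R)^'+, `|f x + t * a| = `|f x| + t * A) ->
  semideriv f x d a -> semideriv (fun y => `|f y|) x d A.
Proof.
move=> absE fa; apply/cvgrPdist_le => e e0.
move/cvgrPdist_le : fa => /(_ e e0) fa.
have absE' : \forall p \near filter_prod (0 : R)^'+ (nbhs d),
    `|f x + p.1 * a| = `|f x| + p.1 * A.
  exact: (@cvg_fst _ _ (0 : R)^'+ (nbhs d) _ _ absE).
near=> p; have /andP[p0 _] : 0 < p.1 <= 1 by near: p; exact: near_small.
have ptE : `|f x + p.1 * a| = `|f x| + p.1 * A by near: p.
have -> : A - dquot (fun y => `|f y|) x p.2 p.1 =
    (`|f x + p.1 * a| - `|f (x + p.1 *: p.2)|) / p.1.
  by rewrite ptE /dquot; field; rewrite gt_eqF.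
rewrite normrM normfV (gtr0_norm p0) ler_pdivrMr//.
apply: le_trans (ler_dist_dist _ _) _.
have -> : f x + p.1 * a - f (x + p.1 *: p.2) =
    (a - dquot f x p.2 p.1) * p.1.
  by rewrite /dquot; field; rewrite gt_eqF.
by rewrite normrM (gtr0_norm p0) ler_wpM2r ?(ltW p0)//; near: p.
Unshelve. all: by end_near. Qed.

End Semiderivatives.

Section CoordinateSelection.
Variables (R : realType) (m p : nat) (s : 'I_p -> 'I_m).

Lemma colsub_ray (x d : 'rV[R]_m) (t : R) :
  colsub s (x + t *: d) = colsub s x + t *: colsub s d.
Proof. by apply/rowP => i; rewrite !mxE. Qed.

Lemma colsub_continuous : continuous (fun x : 'rV[R]_m => colsub s x).
Proof.
move=> x; apply/(@cvg_rowP R _ (nbhs x) _ p) => i; rewrite mxE; under eq_fun do rewrite mxE.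
exact: (@coord_continuous R 1 m 0 (s i) x).
Qed.

Lemma cvg_colsub (d : 'rV[R]_m) :
  (q.1, colsub s q.2) @[q --> filter_prod (0 : R)^'+ (nbhs d)] -->
  filter_prod (0 : R)^'+ (nbhs (colsub s d)).
Proof.
have c := cvg_comp _ _ (@cvg_snd _ _ (0 : R)^'+ (nbhs d) _)
  (@colsub_continuous d).
apply: (@cvg_pair _ _ _ (filter_prod (0 : R)^'+ (nbhs d)) (0 : R)^'+
  (nbhs (colsub s d))); last exact: c.
exact: cvg_fst.
Qed.

Lemma semideriv_colsub (f : 'rV[R]_p -> R) (x d : 'rV[R]_m) (a : R) :
  semideriv f (colsub s x) (colsub s d) a ->
  semideriv (fun y => f (colsub s y)) x d a.
Proof.
move=> fa; rewrite /semideriv /dquot; under eq_fun do rewrite colsub_ray.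
exact: (cvg_comp _ _ (@cvg_colsub d) fa).
Qed.

Lemma semideriv2_colsub (f D : 'rV[R]_p -> R) (x d : 'rV[R]_m) (b : R) :
  semideriv2 f D (colsub s x) (colsub s d) b ->
  semideriv2 (fun y => f (colsub s y)) (fun y => D (colsub s y)) x d b.
Proof.
move=> fb; rewrite /semideriv2 /dquot2; under eq_fun do rewrite colsub_ray.
exact: (cvg_comp _ _ (@cvg_colsub d) fb).
Qed.

End CoordinateSelection.

(** * Quadratic growth from directional growth *)

Section DirectionalGrowth.
Variables (R : realType) (m : nat).
Implicit Types (f : 'rV[R]_m -> R) (z d : 'rV[R]_m).

Lemma near_right_interval (A : set R) : (\forall t \near (0 : R)^'+, A t) ->
  \forall e \near (0 : R)^'+, forall t, 0 < t <= e -> A t.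
Proof.
case=> e /= e0 eA; apply: filterS (nbhs_right_lt e0) => r re t /andP[t0 tr]; apply: eA => //=.
by rewrite sub0r normrN gtr0_norm// (le_lt_trans tr).
Qed.

(** Uniformity over directions comes from compactness of the unit sphere; it
    is for this that the growth is required for all directions near [d]. *)
Lemma strong_local_minimizer_directional f z :
  (forall d, norm2 d = 1 -> exists2 c : R, 0 < c &
     \forall p \near filter_prod (0 : R)^'+ (nbhs d),
       f z + c * p.1 ^+ 2 <= f (z + p.1 *: p.2)) ->
  strong_local_minimizer setT f z.
Proof.
move=> growth; split=> //.
pose P (e : R) d := forall t, 0 < t <= e -> f z + e * t ^+ 2 <= f (z + t *: d).
have /compact_near_coveringP cov := @compact_sphere R m.
have [] := @cov R (0 : R)^'+ P _ _.
- move=> d /= d1; have [c c0 [[A B] [/= A0 Bd] AB]] := growth d d1.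
  have cA := near_right_interval A0.
  near=> d' e => t te.
  have tA : forall t, 0 < t <= e -> A t by near: e.
  have ec : e <= c by near: e; exact: nbhs_right_le.
  have Bd' : B d' by near: d'.
  have AB' : f z + c * t ^+ 2 <= f (z + t *: d').
    by apply: (AB (t, d')); split=> //=; exact: tA.
  by apply: le_trans AB'; rewrite lerD2l ler_wpM2r ?sqr_ge0.
(* half the radius, to stay strictly inside the neighbourhood of 0 *)
move=> e /= e0 eP; exists (e / 2), (e / 2); split; rewrite ?divr_gt0//.
move=> y _ ye; have [->|yz] := eqVneq y z.
  by rewrite subrr norm2_0 expr0n mulr0 addr0.
have yz0 : y - z != 0 by rewrite subr_eq0.
have t0 := norm2_gt0 yz0; set t := norm2 (y - z) in ye t0 *.
have -> : f y = f (z + t *: (t^-1 *: (y - z))).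
  by rewrite scalerA divff ?gt_eqF// scale1r addrC subrK.
have e2 : e / 2 < e by rewrite ltr_pdivrMr// ltr_pMr// ltr1n.
apply: (eP (e / 2)) => //=; rewrite ?divr_gt0//.
- by rewrite sub0r normrN gtr0_norm ?divr_gt0.
- by rewrite norm2Z gtr0_norm ?invr_gt0// -/t mulVf// gt_eqF.
- by rewrite t0.
Unshelve. all: by end_near. Qed.

End DirectionalGrowth.

(** * Feed-forward families *)

Section FeedForward.
Variables (R : realType) (N : nat -> nat).
Variable b : forall l : nat, 'rV[R]_(Nbar N l) -> 'rV[R]_(N l.+1).

(** The vector whose blocks are computed one after the other by [b]; it covers
    both the forward pass of the network and the descent direction built from
    the residuals. *)
Fixpoint assemble (l : nat) : 'rV[R]_(Nbar N l) :=
  if l is k.+1 return 'rV[R]_(Nbar N l)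
  then row_mx (assemble k) (b (assemble k)) else 0.

Lemma uprefix_assemble (L k : nat) (hk : (k <= L)%N) :
  uprefix hk (assemble L) = assemble k.
Proof.
apply/rowP => i; rewrite mxE.
elim: L hk => [|L IH] hk.
  by case: k hk i => [|k] // hk i; congr (_ 0 _); exact: val_inj.
have [kL|kL] := eqVneq k L.+1.
  by subst k; congr (assemble _ 0 _); exact: val_inj.
have hk' : (k <= L)%N by rewrite -ltnS ltn_neqAle kL.
rewrite -(IH hk') /=.
have -> : widen_ord (leq_Nbar N hk) i =
    lshift (N L.+1) (widen_ord (leq_Nbar N hk') i) by exact: val_inj.
by rewrite row_mxEl.
Qed.

Lemma ublock_assemble (L : nat) (l : 'I_L) :
  ublock l (assemble L) = b (assemble l).
Proof. by rewrite /ublock uprefix_assemble /= row_mxKr. Qed.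

(** A discrete Gronwall estimate: a block grows by a factor [1 + K k] and
    receives the input [rho k]. *)
Lemma norm2_assemble_le (L : nat) (K rho : nat -> R) :
  (forall k, (0 < k < L)%N -> 0 <= K k) ->
  (forall k, (k < L)%N ->
     norm2 (b (assemble k)) <= K k * norm2 (assemble k) + rho k) ->
  forall k, (k <= L)%N -> norm2 (assemble k) <=
    \sum_(l < k) rho l * \prod_(l.+2 <= j < k.+1) (1 + K j.-1).
Proof.
move=> K0 bK; elim=> [_|k IH kL]; first by rewrite big_ord0 norm2_0.
have kL' := ltnW kL.
apply: le_trans (norm2_row_mx_le _ _) _.
apply: (@le_trans _ _ ((1 + K k) * norm2 (assemble k) + rho k)).
  by rewrite mulrDl mul1r -addrA lerD2l bK.
rewrite big_ord_recr/= [X in _ + _ * X]big_geq// mulr1 lerD2r.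
(* nothing bounds [K 0] below, but the prefix before layer 0 is empty *)
case: k => [|k] in IH kL kL' *; first by rewrite norm2_0 mulr0 big_ord0.
apply: le_trans (ler_wpM2l _ (IH kL')) _; first by rewrite addr_ge0// K0.
rewrite mulr_sumr le_eqVlt; apply/orP; left; apply/eqP.
apply: eq_bigr => i _; rewrite [in RHS]big_nat_recr/=; last by rewrite !ltnS leq_ord.
ring.
Qed.

End FeedForward.

(** * The penalised network objective *)

Section Network.
Variables (R : realType) (n L : nat) (N : nat -> nat).
Variable g : 'rV[R]_(Nbar N L) -> R.
Variable psi : forall l : nat, 'rV[R]_(n + Nbar N l) -> 'rV[R]_(N l.+1).
Variables (lambda : R) (beta : nat -> R).
Implicit Types (theta : 'rV[R]_n) (u e : 'rV[R]_(Nbar N L))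
  (z d : 'rV[R]_(n + Nbar N L)) (l : 'I_L).

Local Notation F := (F g lambda).
Local Notation Theta := (Theta g psi lambda beta).

Hypothesis g_semidiff : forall u, twice_semidiff g u.
Hypothesis psi_semidiff : forall l : nat, (l < L)%N ->
  forall j x, twice_semidiff (component (@psi l) j) x.
Hypothesis beta_gt0 : forall l : nat, (1 <= l <= L)%N -> 0 < beta l.

Lemma beta_ge0 l : 0 <= beta l.+1.
Proof. by rewrite ltW// beta_gt0//= ltn_ord. Qed.

(** The blocks of [z] read by layer [l] and by its residual are selections of
    coordinates, which gives their linearity and continuity at once. *)
Definition layer_sel l (i : 'I_(n + Nbar N l)) : 'I_(n + Nbar N L) :=
  match fintype.split i with
  | inl j => lshift _ j
  | inr k => rshift n (widen_ord (leq_Nbar N (ltnW (ltn_ord l))) k)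
  end.

Definition block_sel l (j : 'I_(N l.+1)) : 'I_(n + Nbar N L) :=
  rshift n (widen_ord (leq_Nbar N (ltn_ord l)) (rshift (Nbar N l) j)).

Lemma layer_inputE l z : layer_input l z = colsub (@layer_sel l) z.
Proof.
apply/rowP => i; rewrite !mxE /layer_sel.
by case: fintype.split => k; rewrite !mxE.
Qed.

Lemma ublockE l z j : ublock l (rsubmx z) 0 j = z 0 (@block_sel l j).
Proof. by rewrite !mxE. Qed.

Lemma rsubmxE z : rsubmx z = colsub (@rshift n (Nbar N L)) z.
Proof. by apply/rowP => i; rewrite !mxE. Qed.

Lemma layer_input_ray l z d (t : R) :
  layer_input l (z + t *: d) = layer_input l z + t *: layer_input l d.
Proof. by rewrite !layer_inputE colsub_ray. Qed.

Definition slopeF z d : R :=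
  dird g (rsubmx z) (rsubmx d) +
  lambda * \sum_i 2 * z 0 (lshift _ i) * d 0 (lshift _ i).

Lemma FE : F = fun z => g (colsub (@rshift n (Nbar N L)) z) +
  lambda * \sum_i z 0 (lshift _ i) ^+ 2.
Proof.
apply/funext => z; rewrite /Defs.F rsubmxE sqr_norm2.
by congr (_ + _ * _); apply: eq_bigr => i _; rewrite mxE.
Qed.

Lemma semideriv_F z d : semideriv F z d (slopeF z d).
Proof.
rewrite FE; apply: semiderivD.
  rewrite !rsubmxE; apply: semideriv_colsub.
  exact/twice_semidiff_semideriv.
apply: semiderivZ; apply: semideriv_sum => i.
apply: semideriv2_semideriv (@semideriv2_sqr_coord R _ z d (lshift _ i)).
apply: cvgM; first exact: cvg_cst.
exact: (@coord_continuous R 1 _ 0 (lshift _ i) d).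
Qed.

Lemma dird_F z : dird F z = slopeF z.
Proof. by apply/funext => d; exact/semideriv_dird/semideriv_F. Qed.

Lemma semideriv2_F z d : semideriv2 F (dird F z) z d (dird2 F z d).
Proof.
suff [b Fb] : exists b, semideriv2 F (dird F z) z d b.
  by rewrite (semideriv2_dird2 Fb).
have DE : dird F z = fun y =>
    dird g (colsub (@rshift n _) z) (colsub (@rshift n _) y) +
    lambda * \sum_i 2 * z 0 (lshift _ i) * y 0 (lshift _ i).
  by rewrite dird_F; apply/funext => y; rewrite /slopeF !rsubmxE.
rewrite DE FE; eexists.
apply: semideriv2D.
  by apply: semideriv2_colsub; exact: twice_semidiff_semideriv2.
apply: semideriv2Z; apply: semideriv2_sum => i; exact: semideriv2_sqr_coord.
Qed.

Definition resid l z : 'rV[R]_(N l.+1) :=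
  ublock l (rsubmx z) - psi (layer_input l z).

Definition slope_resid l z d : 'rV[R]_(N l.+1) := ublock l (rsubmx d) -
  \row_j dird (component (@psi l) j) (layer_input l z) (layer_input l d).

Lemma residE l z j : resid l z 0 j =
  z 0 (@block_sel l j) - component (@psi l) j (layer_input l z).
Proof. by rewrite /resid mxE ublockE [X in _ + X]mxE. Qed.

Lemma slope_residE l z d j : slope_resid l z d 0 j = d 0 (@block_sel l j) -
  dird (component (@psi l) j) (layer_input l z) (layer_input l d).
Proof. by rewrite /slope_resid mxE ublockE [X in _ + X]mxE [X in _ - X]mxE. Qed.

Lemma ThetaE : Theta = fun z => F z +
  \sum_(l < L) beta l.+1 * \sum_j `|resid l z 0 j|.
Proof. by []. Qed.

Lemma semideriv_resid l z d j :
  semideriv (fun y => resid l y 0 j) z d (slope_resid l z d 0 j).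
Proof.
have -> : (fun y => resid l y 0 j) = fun y => y 0 (@block_sel l j) +
    -1 * component (@psi l) j (colsub (@layer_sel l) y).
  by apply/funext => y; rewrite residE layer_inputE mulN1r.
rewrite slope_residE -[X in _ + X]mulN1r; apply: semiderivD; first exact: semideriv_coord.
apply: semiderivZ; rewrite !layer_inputE; apply: semideriv_colsub.
exact/twice_semidiff_semideriv/psi_semidiff.
Qed.

Lemma semideriv_Theta z d (A : forall l, 'I_(N l.+1) -> R) :
  (forall l j, \forall t \near (0 : R)^'+,
    `|resid l z 0 j + t * slope_resid l z d 0 j| =
    `|resid l z 0 j| + t * A l j) ->
  semideriv Theta z d (slopeF z d + \sum_(l < L) beta l.+1 * \sum_j A l j).
Proof.
move=> absE; rewrite ThetaE; apply: semiderivD; first exact: semideriv_F.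
apply: semideriv_sum => l; apply: semiderivZ; apply: semideriv_sum => j.
exact: semideriv_norm (absE l j) (@semideriv_resid l z d j).
Qed.

(** At a feasible point each penalty term contributes the absolute value of the
    slope of its residual. *)
Lemma semideriv_Theta_feasible z d : (forall l, resid l z = 0) ->
  semideriv Theta z d
    (slopeF z d + \sum_(l < L) beta l.+1 * norm1 (slope_resid l z d)).
Proof.
move=> z0; apply: semideriv_Theta => l j.
apply: filterS (nbhs_right_gt 0) => t t0.
by rewrite z0 mxE normr0 !add0r normrM gtr0_norm.
Qed.

(** If first-order changes cancel every residual, then each penalty term decreases
    at the rate of its own size. *)
Lemma semideriv_Theta_descent z d : (forall l, slope_resid l z d = - resid l z) ->
  semideriv Theta z d (slopeF z d - \sum_(l < L) beta l.+1 * norm1 (resid l z)).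
Proof.
move=> zd.
have zdE l j : slope_resid l z d 0 j = - resid l z 0 j by rewrite zd mxE.
have -> : - (\sum_(l < L) beta l.+1 * norm1 (resid l z)) =
    \sum_(l < L) beta l.+1 * \sum_j - `|resid l z 0 j|.
  by rewrite -sumrN; apply: eq_bigr => l _; rewrite sumrN mulrN.
apply: semideriv_Theta => l j.
apply: filterS (nbhs_right_le ltr01) => t t1; rewrite zdE.
set r := resid l z 0 j.
have -> : r + t * - r = (1 - t) * r by ring.
by rewrite normrM ger0_norm ?subr_ge0//; ring.
Qed.

(** The normalised remainder of [Theta] after its first-order part; it tends to
    the left-hand side of the second-order condition. *)
Definition curvature_quot z (p : R * 'rV[R]_(n + Nbar N L)) : R :=
  dquot2 F (dird F z) z p.2 p.1 -
  \sum_(l < L) beta l.+1 * \sum_j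
    `|dquot2 (component (@psi l) j)
        (dird (component (@psi l) j) (layer_input l z))
        (layer_input l z) (layer_input l p.2) p.1|.

Lemma cvg_curvature_quot z d :
  curvature_quot z p @[p --> filter_prod (0 : R)^'+ (nbhs d)] -->
  dird2 F z d - \sum_(l < L) beta l.+1 *
    norm1 (vdird2 (@psi l) (layer_input l z) (layer_input l d)).
Proof.
rewrite /curvature_quot; apply: (cvgB (@semideriv2_F z d)).
apply: (@cvg_sumr _ _ _ _ _ _ (fun l p => beta l.+1 * \sum_j
    `|dquot2 (component (@psi l) j)
        (dird (component (@psi l) j) (layer_input l z))
        (layer_input l z) (layer_input l p.2) p.1|)) => l.
apply: cvgM; first exact: cvg_cst.
apply: (@cvg_sumr _ _ _ _ _ _ (fun j p =>
    `|dquot2 (component (@psi l) j)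
        (dird (component (@psi l) j) (layer_input l z))
        (layer_input l z) (layer_input l p.2) p.1|)) => j.
apply: cvg_norm; rewrite mxE !layer_inputE.
under eq_fun do rewrite layer_inputE.
have q := @twice_semidiff_semideriv2 R _ (component (@psi l) j)
  (colsub (@layer_sel l) z) (colsub (@layer_sel l) d) (psi_semidiff _ _ _).
exact: (cvg_comp _ _ (@cvg_colsub _ _ _ (@layer_sel l) d) (q (ltn_ord l))).
Qed.

(** A residual at [z + t *: d] is [t] times its slope minus [t ^+ 2 / 2] times the
    second-order quotient of the layer, so by the reverse triangle inequality its
    absolute value loses at most the latter; the slopes of the residuals and of
    [F] add up to [dird Theta z d]. *)
Lemma Theta_expansion z d (t : R) : (forall l, resid l z = 0) -> 0 < t ->
  Theta z + t * dird Theta z d + t ^+ 2 / 2 * curvature_quot z (t, d) <=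
  Theta (z + t *: d).
Proof.
move=> z0 t0; rewrite (semideriv_dird (@semideriv_Theta_feasible z d z0)) !ThetaE.
rewrite -dird_F /curvature_quot/=.
rewrite [X in F z + X]big1; last first.
  by move=> l _; rewrite big1 ?mulr0// => j _; rewrite z0 mxE normr0.
have -> : F (z + t *: d) = F z + t * dird F z d +
    t ^+ 2 / 2 * dquot2 F (dird F z) z d t.
  by rewrite /dquot2; field; rewrite gt_eqF.
rewrite addr0 -subr_ge0.
set S1 := (X in t * (_ + X)); set S2 := (X in _ * (_ - X)).
set S3 := (X in _ + X - _).
have -> : F z + t * dird F z d + t ^+ 2 / 2 * dquot2 F (dird F z) z d t + S3 -
    (F z + t * (dird F z d + S1) +
     t ^+ 2 / 2 * (dquot2 F (dird F z) z d t - S2)) =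
    S3 + t ^+ 2 / 2 * S2 - t * S1 by ring.
rewrite subr_ge0 !mulr_sumr -big_split/=.
apply: ler_sum => l _.
rewrite mulrCA [X in _ <= _ + X]mulrCA -mulrDr ler_wpM2l ?beta_ge0//.
rewrite !mulr_sumr -big_split/=; apply: ler_sum => j _.
set q := dquot2 _ _ _ _ _.
have -> : resid l (z + t *: d) 0 j =
    t * slope_resid l z d 0 j - t ^+ 2 / 2 * q.
  have : resid l z 0 j = 0 by rewrite z0 mxE.
  rewrite !residE slope_residE /q /dquot2 layer_input_ray => /subr0_eq <-.
  have -> i : (z + t *: d) 0 i = z 0 i + t * d 0 i by rewrite !mxE.
  by field; rewrite gt_eqF.
rewrite -[X in X * `|slope_resid _ _ _ _ _|]gtr0_norm// -normrM.
have t2 : 0 <= t ^+ 2 / 2 by rewrite divr_ge0// sqr_ge0.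
rewrite -[X in _ + X * _](ger0_norm t2) -normrM.
by rewrite -lerBlDr; exact: lerB_dist.
Qed.

(** Along a critical direction the nonnegativity of [dird Theta z] at all nearby
    directions leaves the quadratic term; along the others the linear term
    dominates. *)
Lemma Theta_strong_local_minimizer z : (forall l, resid l z = 0) ->
  (forall d, 0 <= dird Theta z d) ->
  (forall d, d != 0 -> dird Theta z d = 0 -> 0 < dird2 F z d -
     \sum_(l < L) beta l.+1 *
       norm1 (vdird2 (@psi l) (layer_input l z) (layer_input l d))) ->
  strong_local_minimizer setT Theta z.
Proof.
move=> z0 first_order second_order.
apply: strong_local_minimizer_directional => d d1.
have d0 : d != 0.
  by apply/eqP => dE; move: d1; rewrite dE norm2_0 => /esym/eqP; rewrite oner_eq0.
have Td := @semideriv_Theta_feasible z d z0.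
have := first_order d; rewrite le_eqVlt => /orP[/eqP a0|a0].
  have c0 := second_order d d0 (esym a0).
  set c := (X in 0 < X) in c0.
  have c2 : c / 2 < c by rewrite ltr_pdivrMr// ltr_pMr// ltr1n.
  exists (c / 4); first by rewrite divr_gt0.
  have near_c := cvgr_ge _ (@cvg_curvature_quot z d) _ c2.
  near=> p.
  have /andP[t0 _] : 0 < p.1 <= 1 by near: p; exact: near_small.
  have cp : c / 2 <= curvature_quot z p by near: p; exact: near_c.
  apply: le_trans (Theta_expansion p.2 z0 t0).
  rewrite -[leRHS]addrA lerD2l -[leLHS]add0r lerD ?mulr_ge0 ?(ltW t0)//.
  rewrite -surjective_pairing.
  have -> : c / 4 * p.1 ^+ 2 = p.1 ^+ 2 / 2 * (c / 2) by field.
  by rewrite ler_wpM2l// divr_ge0// sqr_ge0.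
rewrite (semideriv_dird Td) in a0; set a := (X in 0 < X) in a0 Td.
have a2 : a / 2 < a by rewrite ltr_pdivrMr// ltr_pMr// ltr1n.
(* steps are at most 1, so linear growth is at least quadratic growth *)
exists (a / 2); first by rewrite divr_gt0.
have near_a := cvgr_ge _ Td _ a2.
near=> p.
have /andP[t0 t1] : 0 < p.1 <= 1 by near: p; exact: near_small.
have : a / 2 <= dquot Theta z p.2 p.1 by near: p; exact: near_a.
rewrite /dquot ler_pdivlMr// lerBrDl; apply: le_trans.
rewrite lerD2l ler_wpM2l ?divr_ge0 ?(ltW a0)//.
by rewrite expr2 ger_pMr.
Unshelve. all: by end_near. Qed.

End Network.

Lemma dird0 (R : realType) (m : nat) (f : 'rV[R]_m -> R) x : dird f x 0 = 0.
Proof.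
rewrite /dird /dquot; under eq_fun do rewrite scaler0 addr0 subrr mul0r.
by apply: cvg_lim => //; exact: cvg_cst.
Qed.

(** * Stationary points are feasible *)

(** Extends a family indexed by the layers to all indices, as [assemble] needs. *)
Definition total_family (L : nat) (T : nat -> Type) (dflt : forall l, T l)
    (f : forall l : 'I_L, T l) (l : nat) : T l :=
  match decP (@idP (l < L)%N) with
  | left h => f (Ordinal h)
  | right _ => dflt l
  end.

Lemma total_familyE (L : nat) (T : nat -> Type) (dflt : forall l, T l)
    (f : forall l : 'I_L, T l) (l : 'I_L) : total_family dflt f l = f l.
Proof.
rewrite /total_family; case: l => l hl /=; case: decP => // h.
by rewrite (bool_irrelevance h hl).
Qed.

Section Feasibility.
Variables (R : realType) (n L : nat) (N : nat -> nat).
Variable g : 'rV[R]_(Nbar N L) -> R.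
Variable psi : forall l : nat, 'rV[R]_(n + Nbar N l) -> 'rV[R]_(N l.+1).
Variables (lambda : R) (beta : nat -> R) (Kg : R) (K : nat -> R).
Implicit Types (theta : 'rV[R]_n) (u e : 'rV[R]_(Nbar N L))
  (z d : 'rV[R]_(n + Nbar N L)) (l : 'I_L).

Local Notation Theta := (Theta g psi lambda beta).
Local Notation resid := (resid psi).

Hypothesis g_semidiff : forall u, twice_semidiff g u.
Hypothesis psi_semidiff : forall l : nat, (l < L)%N ->
  forall j x, twice_semidiff (component (@psi l) j) x.
Hypothesis Kg_gt0 : 0 < Kg.
Hypothesis K_gt0 : forall l : nat, (1 <= l < L)%N -> 0 < K l.
Hypothesis hK : lipschitz_constants g psi lambda beta Kg K.
Hypothesis hbeta : forall l : nat, (1 <= l <= L)%N ->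
  Kg * \prod_(l.+1 <= j < L.+1) (1 + K j.-1) < beta l.

Lemma near_lev_fattened (eps : R) z d : 0 < eps -> lev g psi lambda beta z ->
  \forall t \near (0 : R)^'+, lev_fattened g psi lambda beta eps (z + t *: d).
Proof.
move=> eps0 zlev; have d1 : 0 < 1 + norm2 d by rewrite ltr_pwDl// norm2_ge0.
apply: filterS2 (nbhs_right_gt 0) (nbhs_right_le (divr_gt0 eps0 d1)) => t t0.
rewrite ler_pdivlMr// => te; exists z => //.
rewrite addrC addKr norm2Z gtr0_norm//; apply: le_trans te.
by rewrite ler_wpM2l ?(ltW t0)// lerDr.
Qed.

Lemma row_mx_ray z e (t : R) :
  z + t *: row_mx 0 e = row_mx (lsubmx z) (rsubmx z + t *: e).
Proof.
by rewrite -{1}(hsubmxK z) scale_row_mx scaler0 add_row_mx addr0.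
Qed.

Lemma dird_g_le z e : lev g psi lambda beta z ->
  dird g (rsubmx z) e <= Kg * norm2 e.
Proof.
move=> zlev; have [eps [eps0 gK _]] := hK.
have ge := semideriv_cvg (@twice_semidiff_semideriv _ _ _ _ e (g_semidiff (rsubmx z))).
apply: cvgr_to_le ge _.
apply: filterS2 (nbhs_right_gt 0) (@near_lev_fattened eps z (row_mx 0 e) eps0 zlev).
move=> t t0; rewrite row_mx_ray => tlev.
rewrite /dquot ler_pdivrMr//; apply: le_trans (ler_norm _) _.
apply: le_trans (gK (lsubmx z) _ _ tlev _) _.
  by rewrite hsubmxK; exists z => //; rewrite subrr norm2_0 ltW.
by rewrite addrC addKr norm2Z gtr0_norm// mulrCA mulrC.
Qed.

Lemma norm2_dird_psi_le z e l : (0 < l)%N -> lev g psi lambda beta z ->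
  norm2 (\row_j dird (component (@psi l) j) (layer_input l z)
    (layer_input l (row_mx 0 e))) <=
  K l * norm2 (uprefix (ltnW (ltn_ord l)) e).
Proof.
move=> l0 zlev; have [eps [eps0 _ psiK]] := hK.
pose q (t : R) : 'rV[R]_(N l.+1) := \row_j dquot (component (@psi l) j)
  (layer_input l z) (layer_input l (row_mx 0 e)) t.
have qcvg : q t @[t --> (0 : R)^'+] --> (\row_j dird (component (@psi l) j)
    (layer_input l z) (layer_input l (row_mx 0 e)) : 'rV[R]_(N l.+1)).
  apply/cvg_rowP => j; rewrite mxE; under eq_fun do rewrite mxE.
  apply: semideriv_cvg; apply: twice_semidiff_semideriv.
  exact: psi_semidiff.
apply: cvgr_to_le (cvg_norm2 qcvg) _.
apply: filterS2 (nbhs_right_gt 0) (@near_lev_fattened eps z (row_mx 0 e) eps0 zlev).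
move=> t t0 tlev.
have -> : q t = t^-1 *: (psi (layer_input l (z + t *: row_mx 0 e)) -
    psi (layer_input l z)).
  by apply/rowP => j; rewrite !mxE /dquot layer_input_ray mulrC.
rewrite norm2Z gtr0_norm ?invr_gt0// ler_pdivrMl//.
move: tlev; rewrite row_mx_ray => tlev.
have zlev' : lev_fattened g psi lambda beta eps (row_mx (lsubmx z) (rsubmx z)).
  by rewrite hsubmxK; exists z => //; rewrite subrr norm2_0 ltW.
have := psiK l _ _ _ l0 tlev zlev'; rewrite [row_mx _ (rsubmx z)]hsubmxK => h.
apply: le_trans h _.
have -> : uprefix (ltnW (ltn_ord l)) (rsubmx z + t *: e) -
    uprefix (ltnW (ltn_ord l)) (rsubmx z) =
    t *: uprefix (ltnW (ltn_ord l)) e.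
  by apply/rowP => i; rewrite !mxE addrC addKr.
by rewrite norm2Z gtr0_norm// mulrCA.
Qed.

(** Along [d], [theta] is fixed and each block moves by the linearised response
    to the preceding blocks minus its own residual. Then every residual shrinks to
    first order, while by the Gronwall estimate [g] increases by at most
    [Kg * \prod (1 + K j)] per unit of residual, which is less than the penalty
    saved unless all residuals vanish. *)
Lemma stationary_feasible z : lev g psi lambda beta z ->
  (forall d, 0 <= dird Theta z d) -> forall l, resid l z = 0.
Proof.
move=> zlev first_order.
pose r := total_family (fun k => 0 : 'rV[R]_(N k.+1)) (fun l => resid l z).
pose x := total_family (fun k => 0 : 'rV[R]_(n + Nbar N k))
  (fun l => layer_input l z).
pose b k (v : 'rV[R]_(Nbar N k)) : 'rV[R]_(N k.+1) :=
  \row_j dird (component (@psi k) j) (x k) (row_mx 0 v) - r k.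
pose e := assemble b L; pose d : 'rV[R]_(n + Nbar N L) := row_mx 0 e.
have dl l : layer_input l d = row_mx 0 (assemble b l).
  by rewrite /layer_input row_mxKl row_mxKr uprefix_assemble.
have bE l : b l (assemble b l) = \row_j dird (component (@psi l) j)
    (layer_input l z) (layer_input l d) - resid l z.
  by rewrite /b /r /x !total_familyE dl.
have slope_d l : slope_resid psi l z d = - resid l z.
  rewrite /slope_resid /d row_mxKr ublock_assemble bE.
  by rewrite addrC addKr.
have e_le : norm2 e <=
    \sum_(l < L) norm1 (r l) * \prod_(l.+2 <= j < L.+1) (1 + K j.-1).
  apply: (@norm2_assemble_le _ _ b L K (fun k => norm1 (r k))) => //.
    by move=> k /K_gt0/ltW.
  move=> k kL; pose l := Ordinal kL.
  have -> : b k (assemble b k) = b l (assemble b l) by [].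
  rewrite bE; apply: le_trans (ler_norm2D _ _) _; rewrite norm2N.
  have -> : r k = resid l z by exact: (total_familyE _ _ l).
  apply: lerD; last exact: norm2_le_norm1.
  have [k0|k0] := posnP k.
    subst k; rewrite /= norm2_0 mulr0.
    have -> : \row_j dird (component (@psi 0) j) (layer_input l z)
      (layer_input l d) = 0; last by rewrite norm2_0.
    by apply/rowP => j; rewrite !mxE (dl l)/= row_mx0 dird0.
  have := @norm2_dird_psi_le z e l k0 zlev.
  by rewrite uprefix_assemble.
have dT := semideriv_dird (@semideriv_Theta_descent R n L N g psi lambda beta
  g_semidiff psi_semidiff z d slope_d).
have slopeE : slopeF g lambda z d = dird g (rsubmx z) e.
  rewrite /slopeF /d row_mxKr big1 ?mulr0 ?addr0// => i _.
  by rewrite row_mxEl mxE mulr0.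
pose P l : R := Kg * \prod_(l.+2 <= j < L.+1) (1 + K j.-1).
have gap l : 0 < beta l.+1 - P l by rewrite subr_gt0 hbeta//= ltn_ord.
have sum_le0 : \sum_(l < L) (beta l.+1 - P l) * norm1 (resid l z) <= 0.
  have := first_order d; rewrite dT slopeE subr_ge0 => le_g.
  under eq_bigr do rewrite mulrBl; rewrite sumrB subr_le0.
  apply: le_trans le_g _; apply: le_trans (dird_g_le _ zlev) _.
  apply: le_trans (ler_wpM2l (ltW Kg_gt0) e_le) _.
  rewrite mulr_sumr le_eqVlt; apply/orP; left; apply/eqP; apply: eq_bigr => l _.
  by rewrite /r total_familyE /P mulrCA mulrC.
have term_ge0 l : 0 <= (beta l.+1 - P l) * norm1 (resid l z).
  by rewrite mulr_ge0 ?norm1_ge0// ltW.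
move=> l; apply: norm1_eq0; apply/eqP.
have : (beta l.+1 - P l) * norm1 (resid l z) = 0.
  have sum0 : \sum_(l < L) (beta l.+1 - P l) * norm1 (resid l z) = 0.
    by apply/eqP; rewrite eq_le sum_le0 sumr_ge0.
  by move: sum0 => /psumr_eq0P ->.
by move/eqP; rewrite mulf_eq0 gt_eqF ?gap.
Qed.

End Feasibility.

(** * From the penalised problem back to the network problem *)

Section Reduction.
Variables (R : realType) (n L : nat) (N : nat -> nat).
Variable g : 'rV[R]_(Nbar N L) -> R.
Variable psi : forall l : nat, 'rV[R]_(n + Nbar N l) -> 'rV[R]_(N l.+1).
Variables (lambda : R) (beta : nat -> R).
Implicit Types (theta : 'rV[R]_n) (z : 'rV[R]_(n + Nbar N L)) (l : 'I_L).

Local Notation Theta := (Theta g psi lambda beta).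

Definition feasible_point theta : 'rV[R]_(n + Nbar N L) :=
  row_mx theta (forward psi theta L).

Lemma forwardE theta k :
  forward psi theta k = assemble (fun (i : nat) v => @psi i (row_mx theta v)) k.
Proof. by elim: k => //= k ->. Qed.

Lemma resid_feasible_point theta l : resid psi l (feasible_point theta) = 0.
Proof.
rewrite /resid /layer_input row_mxKl row_mxKr !forwardE.
by rewrite ublock_assemble uprefix_assemble subrr.
Qed.

Lemma Theta_feasible_point theta :
  Theta (feasible_point theta) = objP g psi lambda theta.
Proof.
rewrite ThetaE big1 ?addr0.
  by rewrite /F row_mxKl row_mxKr.
by move=> l _; rewrite big1 ?mulr0// => j _; rewrite resid_feasible_point mxE normr0.
Qed.

Lemma feasible_pointP z : (forall l, resid psi l z = 0) ->
  feasible_point (lsubmx z) = z.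
Proof.
move=> z0; rewrite -[RHS]hsubmxK; congr row_mx.
have prefixE k (hk : (k <= L)%N) :
    uprefix hk (rsubmx z) = forward psi (lsubmx z) k.
  elim: k hk => [|k IH] hk; first by apply/rowP => -[].
  have := z0 (Ordinal hk); rewrite /resid /layer_input/= => /subr0_eq.
  rewrite (_ : uprefix _ _ = forward psi (lsubmx z) k) => [bE|]; last first.
    exact: IH.
  rewrite /= -bE -[LHS]hsubmxK; congr row_mx; last first.
    by rewrite /ublock (bool_irrelevance (ltn_ord (Ordinal hk)) hk).
  rewrite -(IH (ltnW hk)); apply/rowP => i; rewrite !mxE; congr (_ _ _ _).
  exact: val_inj.
rewrite -(prefixE L (leqnn L)); apply/rowP => i; rewrite !mxE; congr (_ _ _ _).
exact: val_inj.
Qed.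

Lemma feasible_point_continuous :
  (forall l : nat, (l < L)%N -> continuous (@psi l)) ->
  continuous feasible_point.
Proof.
move=> psi_cont theta.
have id_cvg : (t : 'rV[R]_n) @[t --> theta] --> theta by exact: cvg_id.
have fwd k : (k <= L)%N ->
    forward psi t k @[t --> theta] --> forward psi theta k.
  elim: k => [|k IH] kL /=.
    exact: (@cvg_cst _ (0 : 'rV[R]_0) _ (nbhs theta) _).
  have fk := IH (ltnW kL).
  have pk : psi (row_mx t (forward psi t k)) @[t --> theta] -->
      psi (row_mx theta (forward psi theta k)).
    exact: (cvg_comp _ _ (cvg_row_mx id_cvg fk) (psi_cont k kL _)).
  have := @cvg_row_mx R _ (nbhs theta) _ _ _ _ _ _ _ fk pk.
  exact.
exact: (cvg_row_mx id_cvg (fwd L (leqnn L))).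
Qed.

(** The graph of the network is a continuous image of the parameters and
    moves at least as much as they do, so growth of [Theta] restricts to it. *)
Lemma objP_strong_local_minimizer z :
  (forall l : nat, (l < L)%N -> continuous (@psi l)) ->
  (forall l, resid psi l z = 0) -> strong_local_minimizer setT Theta z ->
  strong_local_minimizer setT (objP g psi lambda) (lsubmx z).
Proof.
move=> psi_cont z0 [_ [e1 [e2 [e1_gt0 e2_gt0 growth]]]]; split=> //.
have zE := feasible_pointP z0.
have fz : feasible_point t - z @[t --> lsubmx z] --> z - z.
  have c : feasible_point t @[t --> lsubmx z] --> feasible_point (lsubmx z).
    exact: feasible_point_continuous.
  rewrite zE in c; exact: (cvgB c (@cvg_cst _ z _ (nbhs (lsubmx z)) _)).
have fz0 : norm2 (feasible_point t - z) @[t --> lsubmx z] --> (0 : R).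
  by rewrite -(norm2_0 R (n + Nbar N L)) -(subrr z); exact: (cvg_norm2 fz).
have near_z : \forall t \near lsubmx z, norm2 (feasible_point t - z) < e2.
  exact: (cvgr_lt _ fz0).
move/nbhs_ballP : near_z => [r /= r0 rB].
exists e1, (r / 2); split; rewrite ?divr_gt0// => theta _ theta_r.
rewrite -!Theta_feasible_point zE.
have near_z : norm2 (feasible_point theta - z) <= e2.
  apply/ltW/rB; rewrite -ball_normE /= distrC.
  apply: le_lt_trans (normr_le_norm2 _) _; apply: le_lt_trans theta_r _.
  by rewrite ltr_pdivrMr// ltr_pMr// ltr1n.
apply: le_trans (growth _ I near_z); rewrite lerD2l ler_wpM2l ?(ltW e1_gt0)//.
rewrite ler_pXn2r ?nnegrE ?norm2_ge0//.
have -> : theta - lsubmx z = lsubmx (feasible_point theta - z).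
  by rewrite linearB/= row_mxKl.
exact: norm2_lsubmx_le.
Qed.

End Reduction.

Theorem theorem3p4 (R : realType) (n L : nat) (N : nat -> nat)
    (hn : (0 < n)%N) (hL : (0 < L)%N)
    (hN : forall l : nat, (1 <= l <= L)%N -> (0 < N l)%N)
    (lambda : R) (hlambda : 0 < lambda)
    (g : 'rV[R]_(Nbar N L) -> R)
    (psi : forall l : nat, 'rV[R]_(n + Nbar N l) -> 'rV[R]_(N l.+1))
    (g_ge0 : forall u, 0 <= g u)
    (g_cont : continuous g)
    (psi_cont : forall l : nat, (l < L)%N -> continuous (psi l))
    (g_dirdiff : dirdiff g)
    (psi_dirdiff : forall l : nat, (l < L)%N ->
       forall j, dirdiff (component (psi l) j))
    (g_lip : locally_lipschitz g)
    (psi_lip : forall l : nat, (l < L)%N -> locally_lipschitz (psi l))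
    (g_semidiff : forall u, twice_semidiff g u)
    (psi_semidiff : forall l : nat, (l < L)%N ->
       forall j x, twice_semidiff (component (psi l) j) x)
    (beta : nat -> R)
    (beta_gt0 : forall l : nat, (1 <= l <= L)%N -> 0 < beta l)
    (Kg : R) (K : nat -> R)
    (Kg_gt0 : 0 < Kg)
    (K_gt0 : forall l : nat, (1 <= l < L)%N -> 0 < K l)
    (hK : lipschitz_constants g psi lambda beta Kg K)
    (hbeta : forall l : nat, (1 <= l <= L)%N ->
       Kg * \prod_(l.+1 <= j < L.+1) (1 + K j.-1) < beta l)
    (z : 'rV[R]_(n + Nbar N L))
    (hz : lev g psi lambda beta z)
    (first_order : forall d : 'rV[R]_(n + Nbar N L),
       0 <= dird (Theta g psi lambda beta) z d)
    (second_order : forall d : 'rV[R]_(n + Nbar N L),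
       d != 0 -> dird (Theta g psi lambda beta) z d = 0 ->
       0 < dird2 (F g lambda) z d -
           \sum_(l < L) beta l.+1 *
             norm1 (vdird2 (psi l) (layer_input l z) (layer_input l d))) :
  strong_local_minimizer setT (Theta g psi lambda beta) z /\
  strong_local_minimizer setT (objP g psi lambda) (lsubmx z).
Proof.
have z0 := stationary_feasible g_semidiff psi_semidiff Kg_gt0 K_gt0 hK hbeta hz
  first_order.
have zmin := Theta_strong_local_minimizer g_semidiff psi_semidiff beta_gt0 z0
  first_order second_order.
by split=> //; exact: objP_strong_local_minimizer psi_cont z0 zmin.
Qed.
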